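(* Let $k\ge1$ and $n\ge1$. The number of descending strictly $k$-Naples parking functions of length $n$ is $\frac{k+1}{n}\binom{2n}{n+k+1}$.
   Context: Parking rules: $n$ spots $1,\dots,n$; cars $c_1,\dots,c_n$ arrive in order with preferences $a_j\in[n]$; $k$-Naples rule: $c_j$ parks at $a_j$ if empty, otherwise checks spots $a_j-1,\dots,a_j-k$ (those $\ge1$) in order and parks in the first empty one, otherwise drives forward from $a_j$ and parks in the first empty spot after $a_j$ (failing if none). A preference is a $k$-Naples parking function if all cars park ($0$-Naples = ordinary parking functions); it is strictly $k$-Naples if it is $k$-Naples but not $(k-1)$-Naples. Descending means weakly decreasing. $\binom{a}{b}=0$ if $b>a$. *)

(* Defs.v *)
From mathcomp Require Import all_boot all_order all_algebra.

Set Implicit Arguments.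
Unset Strict Implicit.
Unset Printing Implicit Defensive.

(* The spots are the naturals 1, ..., n. The list gives the spots that a car
   with preference a tries, in order: a itself, then those of a-1, ..., a-k
   that are at least 1, then a+1, ..., n. *)
Definition tried_spots (n k a : nat) : seq nat :=
  a :: [seq a - i | i <- iota 1 k & i < a] ++ iota a.+1 (n - a).

Definition parking_spot (n k : nat) (occ : seq nat) (a : nat) : option nat :=
  ohead [seq s <- tried_spots n k a | s \notin occ].

Fixpoint all_park (n k : nat) (occ prefs : seq nat) : bool :=
  if prefs is a :: prefs' then
    if parking_spot n k occ a is Some s then all_park n k (s :: occ) prefs'
    else false
  else true.

(* The element j of 'I_n stands for the spot j + 1. *)
Definition preferences (n : nat) (p : n.-tuple 'I_n) : seq nat :=
  [seq (val j).+1 | j <- p].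

Definition naples (n k : nat) (p : n.-tuple 'I_n) : bool :=
  all_park n k [::] (preferences p).

(* Only meaningful for k >= 1. *)
Definition strictly_naples (n k : nat) (p : n.-tuple 'I_n) : bool :=
  naples k p && ~~ naples (k - 1) p.

Definition descending (n : nat) (p : n.-tuple 'I_n) : bool :=
  sorted geq (preferences p).

(* Main.v *)
Require Import Defs.
From mathcomp Require Import all_boot all_order all_algebra.
From mathcomp Require Import zify ring.

Set Implicit Arguments.
Unset Strict Implicit.
Unset Printing Implicit Defensive.

(** A car that fails has found all its tried spots taken; they are [n - a + k + 1]
   in number when [a > k], and all [n] spots otherwise.  Conversely, in a
   descending preference the first [i] cars all park at spots at least
   [a_i - k].  Hence a descending preference is [k]-Naples iff
   [a_i + i <= n + k + 1] for all [i] (indices from 1).  Sequences under this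
   staircase are counted by the reflection formula, and there are
   ['C(2n-1, n) - 'C(2n-1, n+k+1)] of them; the theorem is the difference of two
   consecutive such counts. *)

(** The bound [s] on the first entry drops by one per entry. Once it reaches 0, any positive entry
    fails, so the truncation of [s.-1] is harmless for preferences. *)
Fixpoint under_stair (s : nat) (t : seq nat) : bool :=
  if t is a :: t' then (a <= s) && under_stair s.-1 t' else true.

Lemma under_stairS s t : under_stair s t -> under_stair s.+1 t.
Proof.
elim: t s => [//|a t IH] [|s] /= /andP[le_as ut]; rewrite (leqW le_as) //=.
exact: IH.
Qed.

Lemma tried_spots_uniq n k a : uniq (tried_spots n k a).
Proof.
rewrite /tried_spots cons_uniq mem_cat cat_uniq iota_uniq andbT.
apply/and3P; split.
- rewrite negb_or mem_iota ltnn andbT; apply/negP => /mapP[i].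
  by rewrite mem_filter mem_iota; lia.
- rewrite map_inj_in_uniq ?filter_uniq ?iota_uniq // => i j.
  by rewrite !mem_filter !mem_iota; lia.
- apply/hasPn => x; rewrite mem_iota => lt_ax; apply/negP => /mapP[i].
  by rewrite mem_filter mem_iota; lia.
Qed.

Lemma mem_tried_spots n k a s : 0 < a <= n ->
  (s \in tried_spots n k a) = (0 < s <= n) && (a <= s + k).
Proof.
move=> a_in; rewrite inE mem_cat mem_iota.
have -> : (s \in [seq a - i | i <- iota 1 k & i < a])
          = [&& 0 < s, s < a & a <= s + k].
  apply/mapP/idP => [[i]|lt_sa]; first by rewrite mem_filter mem_iota; lia.
  by exists (a - s); rewrite ?mem_filter ?mem_iota; lia.
by apply/idP/idP; lia.
Qed.

Lemma size_tried_spots n k a : 0 < a <= n ->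
  minn n (n + k + 1 - a) <= size (tried_spots n k a).
Proof.
move=> a_in; set m := minn _ _.
(* These are the [m] largest spots: [n.+1 - m] equals [maxn 1 (a - k)], the lowest spot tried. *)
rewrite -(size_iota (n.+1 - m) m); apply: uniq_leq_size (iota_uniq _ _) _ => s.
by rewrite mem_iota mem_tried_spots // /m; lia.
Qed.

Lemma parking_spot_Some n k occ a s : parking_spot n k occ a = Some s ->
  (s \in tried_spots n k a) && (s \notin occ).
Proof.
rewrite /parking_spot andbC -(mem_filter (fun x => x \notin occ)).
by case: filter => //= x l [->]; rewrite mem_head.
Qed.

Lemma parking_spot_None n k occ a : parking_spot n k occ a = None ->
  {subset tried_spots n k a <= occ}.
Proof.
rewrite /parking_spot => none s s_tried; apply/negPn/negP => s_free.
have: s \in [seq x <- tried_spots n k a | x \notin occ].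
  by rewrite mem_filter s_free.
by case: filter none.
Qed.

Lemma under_stair_all_park n k occ t :
    all (fun a => 0 < a <= n) t -> size occ + size t <= n ->
  under_stair (n + k - size occ) t -> all_park n k occ t.
Proof.
elim: t occ => //= a t IH occ /andP[a_in t_in] sz /andP[le_a ut].
case E: parking_spot => [s|].
  by apply: IH => //=; rewrite ?subnS //; lia.
(* The tried spots of a failed car are distinct and all in [occ], yet both [n] and [n + k + 1 - a]
   exceed [size occ]. *)
have := leq_trans (size_tried_spots k a_in)
  (uniq_leq_size (tried_spots_uniq n k a) (parking_spot_None E)).
by move: (size occ) sz le_a => m; rewrite geq_min; lia.
Qed.

(** The condition on [occ] and [t] together is the invariant. It survives a car with preference [a]
    parking at [s], because [a <= s + k] and later preferences are at most [a]. *)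
Lemma all_park_under_stair n k occ t :
    all (fun a => 0 < a <= n) t -> sorted geq t ->
    uniq occ -> all (fun s => 0 < s <= n) occ ->
    {in occ & t, forall s a, a <= s + k} ->
  all_park n k occ t -> under_stair (n + k - size occ) t.
Proof.
elim: t occ => //= a t IH occ /andP[a_in t_in] a_t uniq_occ occ_in occ_t.
case E: parking_spot => [s|//] park.
have /andP[] := parking_spot_Some E.
rewrite mem_tried_spots // => /andP[s_in le_as] s_free.
have geq_tr : transitive geq by move=> x y z /=; lia.
move: a_t; rewrite path_sortedE // => /andP[/allP ge_at sorted_t].
apply/andP; split; last first.
  rewrite -subnS; apply: (IH (s :: occ)) => //=; rewrite ?s_free ?s_in //.
  move=> x b; rewrite inE => /predU1P[->|x_occ] b_t.
    by have /= := ge_at _ b_t; lia.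
  by apply: occ_t; rewrite // inE b_t orbT.
(* By the invariant the distinct spots [s :: occ] lie between [maxn 1 (a - k)] and [n]; comparing
   sizes bounds [a]. *)
have /= : size (s :: occ) <= size (iota (maxn 1 (a - k)) (n.+1 - maxn 1 (a - k))).
  apply: uniq_leq_size => [/=|x]; first by rewrite s_free.
  rewrite mem_iota inE => /predU1P[->|x_occ]; first by lia.
  have := allP occ_in x x_occ; have := occ_t x a x_occ (mem_head _ _).
  by lia.
by rewrite size_iota; lia.
Qed.

Lemma preferences_range n (p : n.-tuple 'I_n) :
  all (fun a => 0 < a <= n) (preferences p).
Proof. by rewrite all_map; apply/allP => j _ /=; exact: ltn_ord. Qed.

Lemma naples_under_stair n k (p : n.-tuple 'I_n) : descending p ->
  naples k p = under_stair (n + k) (preferences p).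
Proof.
move=> desc_p; have p_in := preferences_range p.
rewrite -[n + k]subn0; apply/idP/idP; first exact: all_park_under_stair.
by apply: (@under_stair_all_park n k [::]); rewrite ?size_map ?size_tuple.
Qed.

(** Either the first entry is the bound [v], or all entries are below it. The recursion is
    lexicographic in [l] and [v], hence the inner [fix], which lowers [v] at fixed [l] and [s]. *)
Fixpoint stair_seqs (l v s : nat) {struct l} : seq (seq nat) :=
  if l is l'.+1 then
    (fix below v := if v is v'.+1 then
       (if v <= s then [seq v :: t | t <- stair_seqs l' v s.-1] else [::])
         ++ below v'
     else [::]) v
  else [:: [::]].

Lemma stair_seqsS l v s : stair_seqs l.+1 v.+1 s =
  (if v.+1 <= s then [seq v.+1 :: t | t <- stair_seqs l v.+1 s.-1] else [::])
    ++ stair_seqs l.+1 v s.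
Proof. by []. Qed.

(** The head of a descending sequence bounds its tail, as in the recursion of [stair_seqs]. *)
Lemma sorted_geq_cons_range v a t :
  sorted geq (a :: t) && all (fun b => 0 < b <= v) (a :: t) =
  [&& 0 < a <= v, sorted geq t & all (fun b => 0 < b <= a) t].
Proof.
have geq_tr : transitive geq by move=> x y z /=; lia.
rewrite /= path_sortedE // andbCA; case: (boolP (0 < a <= v)) => //= a_in.
rewrite andbC andbA andbC -all_predI; congr (_ && _).
by apply: eq_all => b /=; lia.
Qed.

Lemma mem_stair_seqs l v s t : (t \in stair_seqs l v s) =
  [&& size t == l, sorted geq t && all (fun a => 0 < a <= v) t
    & under_stair s t].
Proof.
elim: l v s t => [|l IHl] v s t; first by rewrite inE; case: t.
elim: v => [|v IHv].
  case: t => // a t; rewrite sorted_geq_cons_range.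
  by rewrite leqn0 lt0n andNb /= andbF.
rewrite stair_seqsS mem_cat IHv.
have -> : (t \in (if v < s then [seq v.+1 :: t' | t' <- stair_seqs l v.+1 s.-1]
                  else [::])) =
  [&& v < s, ohead t == Some v.+1 & behead t \in stair_seqs l v.+1 s.-1].
  case: ifP => //= _; apply/mapP/andP => [[t' t'_in -> //]|[/eqP]].
  by case: t {IHv} => //= a t [->] t_in; exists t.
rewrite IHl; case: t {IHv} => [|a t]; first by rewrite /= andbF.
rewrite !sorted_geq_cons_range /= eqSS.
have -> : (Some a == Some v.+1) = (a == v.+1) by [].
case: eqVneq => [->|ne_av]; last first.
  by rewrite andbF /= [a <= v.+1]leq_eqVlt (negPf ne_av).
by rewrite ltnn leqnn /= andbF orbF andbCA -!andbA; do !bool_congr.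
Qed.

Lemma stair_seqs_uniq l v s : uniq (stair_seqs l v s).
Proof.
elim: l v s => [//|l IHl] v s; elim: v => [//|v IHv].
rewrite stair_seqsS cat_uniq IHv andbT; apply/andP; split.
  by case: ifP => // _; rewrite map_inj_uniq // => t1 t2 [].
apply/hasPn => t; rewrite mem_stair_seqs => t_in; case: ifP => // _.
apply/negP => /mapP[t' _ def_t].
by move: t_in; rewrite def_t sorted_geq_cons_range ltnn andbF /= andbF.
Qed.

(* [v] is shifted so that ['C(l + v, l)] counts all the descending sequences;
   ['C(l + v, s.+1)] is the number of lattice paths reflected at the stair. *)
Lemma size_stair_seqs l v s : v <= s -> l <= s.+1 ->
  size (stair_seqs l v.+1 s) + 'C(l + v, s.+1) = 'C(l + v, l).
Proof.
elim: l v s => [|l IHl] v s le_vs le_ls.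
  by rewrite bin0 bin_small //= ltnS.
elim: v le_vs => [_|v IHv lt_vs].
  case: s le_ls => [|s] le_ls; first by have -> : l = 0 by lia.
  rewrite stair_seqsS cats0 size_map -[s.+1.-1]/s !addn0 binn.
  have := IHl 0 s isT le_ls; rewrite addn0 binn.
  by rewrite binS (@bin_small l s.+2) ?add0n.
have {}IHv := IHv (ltnW lt_vs).
(* Pascal's rule on both binomials matches the split by first entry; [IHv] settles the branch with
   the smaller bound. *)
rewrite stair_seqsS size_cat addnS !binS [X in X + _]addnC addnACA IHv.
congr (_ + _); case: ltnP => [lt_v1s|le_sv1]; last first.
  (* Here no sequence starts with [v.+2], and the remaining binomials agree by symmetry. *)
  have -> : s = v.+1 by lia.
  by rewrite add0n -bin_sub; [congr 'C(_, _); lia | lia].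
have := IHl v.+1 s.-1; rewrite size_map addnS addSn prednK; last by lia.
by apply; lia.
Qed.

Lemma card_descending_naples n k : 0 < n ->
  #|[set p : n.-tuple 'I_n | descending p && naples k p]|
    + 'C(n + n.-1, (n + k).+1) = 'C(n + n.-1, n).
Proof.
move=> n_gt0; rewrite -(@size_stair_seqs n n.-1 (n + k)); try lia.
rewrite prednK //; congr (_ + _).
(* [preferences] maps the counted set bijectively onto [stair_seqs n n (n + k)]. *)
rewrite cardE -(size_map (@preferences n)); apply/perm_size/uniq_perm.
- rewrite map_inj_uniq ?enum_uniq // => p q /inj_map eq_pq.
  by apply/val_inj/eq_pq => i j [/val_inj].
- exact: stair_seqs_uniq.
move=> t; rewrite mem_stair_seqs.
apply/mapP/and3P => [[p]|[/eqP sz /andP[st t_in] ut]].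
  rewrite mem_enum inE => /andP[desc_p]; rewrite naples_under_stair // => up ->.
  by rewrite size_map size_tuple preferences_range andbT.
(* The default of [insubd] is never taken, as the entries of [t] lie in 1, ..., [n]. *)
pose p : n.-tuple 'I_n := [tuple insubd (Ordinal n_gt0) (nth 0 t i).-1 | i < n].
have def_t : t = preferences p.
  apply: (@eq_from_nth _ 0) => [|i].
    by rewrite sz (size_map _ p) (size_tuple p).
  rewrite sz => lt_in; rewrite (nth_map (Ordinal n_gt0)) ?(size_tuple p) //.
  rewrite -[i]/(val (Ordinal lt_in)).
  rewrite -tnth_nth tnth_mktuple val_insubd /=.
  have /andP[gt0 len] : 0 < nth 0 t i <= n.
    by apply: (all_nthP 0 t_in); rewrite sz.
  by rewrite (prednK gt0) len prednK.
exists p => //; rewrite mem_enum inE.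
have desc_p : descending p by rewrite /descending -def_t.
by rewrite desc_p naples_under_stair // -def_t.
Qed.

(** Raising the stair weakens the condition. The sets for successive [k] are thus nested, which
    makes the strict count a difference. *)
Lemma naplesS n k (p : n.-tuple 'I_n) :
  descending p -> naples k p -> naples k.+1 p.
Proof.
by move=> desc_p; rewrite !naples_under_stair // addnS; apply: under_stairS.
Qed.

Lemma card_descending_strictly_naples n k : 0 < n ->
  #|[set p : n.-tuple 'I_n | descending p && strictly_naples k.+1 p]|
    + 'C(n + n.-1, (n + k).+2) = 'C(n + n.-1, (n + k).+1).
Proof.
move=> n_gt0.
set S := [set p | _].
pose N j := [set p : n.-tuple 'I_n | descending p && naples j p].
have -> : S = N k.+1 :\: N k.
  apply/setP => p; rewrite !inE /strictly_naples subn1 /=.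
  by case: descending => //=; rewrite andbC.
have sub : N k \subset N k.+1.
  by apply/subsetP => p; rewrite !inE => /andP[dp /(naplesS dp) ->]; rewrite dp.
have := cardsD (N k.+1) (N k); rewrite (setIidPr sub).
have := subset_leq_card sub.
have := card_descending_naples k n_gt0; have := card_descending_naples k.+1 n_gt0.
rewrite -/(N k) -/(N k.+1) addnS; lia.
Qed.

Local Open Scope ring_scope.

Theorem theorem5p8 (k n : nat) (hk : (1 <= k)%N) (hn : (1 <= n)%N) :
  #|[set p : n.-tuple 'I_n | descending p && strictly_naples k p]|%:R
  = (k + 1)%:R / n%:R * 'C(2 * n, n + k + 1)%:R :> rat.
Proof.
case: k hk => // k _.
have := card_descending_strictly_naples k hn.
have := mul_bin_diag (2 * n) (n + k).+1; have := mul_bin_down (2 * n) (n + k).+2.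
have -> : ((2 * n).-1 = n + n.-1)%N by lia.
have -> : (n + k.+1 + 1 = (n + k).+2)%N by lia.
set c := #|_|; set B := 'C(2 * n, _); set x := 'C(_, _); set y := 'C(_, _).
move=> eq_down eq_diag eq_c.
(* Here [k] is one less than in the statement. Absorption gives [2 * n * x] and [2 * n * y] as
   multiples of [B], with factors [n + k + 2] and [n - k - 2], whose difference is [2 * k.+2]. If
   the latter subtraction truncates, [B] is 0. *)
have {}eq_c : (n * c = k.+2 * B)%N.
  have [le|gt] := leqP (n + k).+2 (2 * n)%N; first by nia.
  have B0 : B = 0%N by rewrite /B bin_small.
  by nia.
have n0 : n%:R != 0 :> rat by rewrite Num.Theory.pnatr_eq0 -lt0n.
apply: (GRing.mulfI n0); rewrite -GRing.natrM eq_c GRing.natrM addn1.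
by field.
Qed.
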